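(* Let $\mathfrak{M}$ be a listable $\mathscr{L}$-structure and let $\rho,\gamma$ be listable presentations of $\mathfrak{M}$. Consider: (i) $\rho$ and $\gamma$ are equivalent; (ii) the class of $\rho$-listable sets equals the class of $\gamma$-listable sets; (iii) the class of $\rho$-listable sets is contained in the class of $\gamma$-listable sets. Then (i) implies (ii) and (ii) implies (iii). Furthermore, if $E_\rho=\{(m,n)\in\mathbb{N}^2:\rho(m)=\rho(n)\}$ is decidable, then (i), (ii), (iii) are equivalent.
   Context: All languages contain $=$, interpreted as equality. Listable means recursively enumerable. For $\rho:\mathbb{N}\to M$ and $S\subseteq M^r$, $\rho^*(S)$ is the preimage of $S$ under the coordinatewise map $\mathbb{N}^r\to M^r$. A listable presentation of $\mathfrak{M}$ (domain $M$) is a surjection $\rho:\mathbb{N}\to M$ with $\rho^*(s^{\mathfrak{M}})$ listable for every symbol $s\in\mathscr{L}$ (function symbols via graphs). $X\subseteq M^r$ is $\rho$-listable if $\rho^*(X)$ is listable. $\rho$ and $\gamma$ are equivalent if $\gamma=\rho\circ\phi$ for some total recursive $\phi:\mathbb{N}\to\mathbb{N}$. *)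

(* Defs.v *)
From mathcomp Require Import all_boot.
From mathcomp Require Import boolp classical_sets.

Set Implicit Arguments.
Unset Strict Implicit.
Unset Printing Implicit Defensive.

Local Open Scope classical_set_scope.

(* Programs for the n-ary partial recursive (mu-recursive) functions. *)
Inductive code : nat -> Type :=
| Zero n : code n
| Succ : code 1
| Proj n (i : 'I_n) : code n
| Comp m n (f : code m) (g : 'I_m -> code n) : code n
| Prec n (f : code n) (g : code n.+2) : code n.+1
| Mu n (f : code n.+1) : code n.

(* Graph of h with h(0, x) = F(x) and h(k+1, x) = G(k, h(k, x), x). *)
Fixpoint prec_graph n (F : n.-tuple nat -> nat -> Prop)
    (G : n.+2.-tuple nat -> nat -> Prop)
    (k : nat) (x : n.-tuple nat) (z : nat) : Prop :=
  match k with
  | 0 => F x z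
  | k'.+1 => exists2 y, prec_graph F G k' x y & G [tuple of k' :: y :: x] z
  end.

(* eval c x y: the partial function computed by c is defined at x, with
   value y. In the clause for Mu, all values below the first zero must be
   defined (and nonzero). *)
Fixpoint eval n (c : code n) : n.-tuple nat -> nat -> Prop :=
  match c in code n return n.-tuple nat -> nat -> Prop with
  | Zero _ => fun _ y => y = 0
  | Succ => fun x y => y = (thead x).+1
  | Proj _ i => fun x y => y = tnth x i
  | Comp m _ f g => fun x z =>
      exists2 y : m.-tuple nat, (forall i, eval (g i) x (tnth y i)) & eval f y z
  | Prec _ f g => fun x z =>
      prec_graph (eval f) (eval g) (thead x) (behead_tuple x) z
  | Mu _ f => fun x k =>
      eval f [tuple of k :: x] 0 /\
      (forall j, j < k -> exists y, eval f [tuple of j :: x] y.+1)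
  end.

Definition total_recursive n (f : n.-tuple nat -> nat) : Prop :=
  exists c : code n, forall x, eval c x (f x).

Definition total_recursive1 (f : nat -> nat) : Prop :=
  total_recursive (fun x : 1.-tuple nat => f (thead x)).

(* Recursively enumerable: empty, or the range of a total recursive function
   from N to N^r. *)
Definition listable r (S : set (r.-tuple nat)) : Prop :=
  S = set0 \/
  exists2 f : nat -> r.-tuple nat,
    (forall i, total_recursive1 (fun k => tnth (f k) i)) & S = range f.

Definition decidable_set r (S : set (r.-tuple nat)) : Prop :=
  total_recursive (fun x => nat_of_bool `[< S x >]).

(* Constants are function symbols of arity 0. Equality belongs to every
   language: see symbol below. *)
Record language := Language {
  funsym : Type;
  fun_arity : funsym -> nat;
  relsym : Type;
  rel_arity : relsym -> nat }.

Record structure (L : language) := Structure {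
  carrier :> Type;
  fun_interp (f : funsym L) : (fun_arity f).-tuple carrier -> carrier;
  rel_interp (R : relsym L) : set ((rel_arity R).-tuple carrier) }.

Inductive symbol (L : language) :=
| EqSym
| RelSym of relsym L
| FunSym of funsym L.

Arguments EqSym {L}.

Definition symbol_dim (L : language) (s : symbol L) : nat :=
  match s with
  | EqSym => 2
  | RelSym R => rel_arity R
  | FunSym f => (fun_arity f).+1
  end.

Definition fun_graph n T (f : n.-tuple T -> T) : set (n.+1.-tuple T) :=
  [set z | exists x : n.-tuple T, z = [tuple of rcons x (f x)]].

Definition symbol_interp (L : language) (M : structure L) (s : symbol L) :
    set ((symbol_dim s).-tuple M) :=
  match s return set ((symbol_dim s).-tuple M) with
  | EqSym => [set z : 2.-tuple M | tnth z ord0 = tnth z ord_max]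
  | RelSym R => @rel_interp L M R
  | FunSym f => fun_graph (@fun_interp L M f)
  end.

Arguments symbol_interp {L} M s.

(* The preimage rho^*(S) under the coordinatewise map N^r -> M^r. *)
Definition pullback T (rho : nat -> T) r (S : set (r.-tuple T)) :
    set (r.-tuple nat) :=
  @map_tuple r nat T rho @^-1` S.

Definition listable_presentation (L : language) (M : structure L)
    (rho : nat -> M) : Prop :=
  (forall x : M, exists n, rho n = x) /\
  (forall s : symbol L, listable (pullback rho (symbol_interp M s))).

Definition listable_structure (L : language) (M : structure L) : Prop :=
  exists rho : nat -> M, listable_presentation rho.

Definition listable_sets T (rho : nat -> T) r : set (set (r.-tuple T)) :=
  [set X | listable (pullback rho X)].

Arguments listable_sets {T} rho r.

Definition equivalent_presentations T (rho gamma : nat -> T) : Prop :=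
  exists2 phi : nat -> nat, total_recursive1 phi & gamma = rho \o phi.

Definition eq_kernel T (rho : nat -> T) : set (2.-tuple nat) :=
  [set m | rho (tnth m ord0) = rho (tnth m ord_max)].

(* Main.v *)
(* For the last part, walk along the first occurrences in [rho] with a recursive
   [h] such that [rho (h k.+1)] depends only on [rho (h k)]. The set of
   consecutive pairs [(rho (h k), rho (h k.+1))] is [rho]-listable, hence
   [gamma]-listable, and searching in its [gamma]-preimage step by step gives a
   recursive [u] with [gamma (u k) = rho (h k)]. Given [m], a search for some [k]
   with [gamma m = gamma (u k)] then yields a [rho]-index [h k] of [gamma m]. *)

Require Import Defs.
From mathcomp Require Import all_boot.
From mathcomp Require Import boolp classical_sets.
From mathcomp Require Import zify.
Local Open Scope classical_set_scope.

Set Implicit Arguments.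
Unset Strict Implicit.
Unset Printing Implicit Defensive.

(** * Composition of recursive functions and maps between tuples *)

Definition recursive_map n m (G : n.-tuple nat -> m.-tuple nat) : Prop :=
  forall i, total_recursive (fun x => tnth (G x) i).

Definition recursive_pred n (b : n.-tuple nat -> bool) : Prop :=
  total_recursive (fun x => nat_of_bool (b x)).

Lemma behead_tuple_cons T n (a : T) (x : n.-tuple T) :
  behead_tuple [tuple of a :: x] = x.
Proof. exact: val_inj. Qed.

Lemma tuple1_thead T (x : 1.-tuple T) : [tuple thead x] = x.
Proof. by apply: eq_from_tnth => i; rewrite (ord1 i). Qed.

Lemma total_recursive_ext n (f g : n.-tuple nat -> nat) :
  f =1 g -> total_recursive f -> total_recursive g.
Proof. by move=> /funext ->. Qed.

Lemma total_recursive_proj n (i : 'I_n) :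
  total_recursive (fun x : n.-tuple nat => tnth x i).
Proof. by exists (Proj i). Qed.

Lemma total_recursive_thead n :
  total_recursive (fun x : n.+1.-tuple nat => thead x).
Proof. exact: (total_recursive_proj ord0). Qed.

Lemma total_recursive_thead_behead n :
  total_recursive (fun x : n.+2.-tuple nat => thead (behead_tuple x)).
Proof.
apply: total_recursive_ext (total_recursive_proj (lift ord0 ord0)) => x.
by rewrite /thead !(tnth_nth 0) /= nth_behead.
Qed.

Lemma total_recursive_comp m n (f : m.-tuple nat -> nat)
    (G : n.-tuple nat -> m.-tuple nat) :
  total_recursive f -> recursive_map G -> total_recursive (fun x => f (G x)).
Proof.
move=> [c fc] /choice[d Gd]; exists (Comp c d) => x /=.
by exists (G x) => // i; exact: Gd.
Qed.

Lemma recursive_map_cons m n (f : n.-tuple nat -> nat)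
    (G : n.-tuple nat -> m.-tuple nat) :
  total_recursive f -> recursive_map G ->
  recursive_map (fun x => [tuple of f x :: G x]).
Proof.
move=> rf rG i; case: (unliftP ord0 i) => [j|] ->.
  by apply: total_recursive_ext (rG j) => x; rewrite tnthS.
by apply: total_recursive_ext rf => x; rewrite tnth0.
Qed.

Lemma recursive_map_nil n (G : n.-tuple nat -> 0.-tuple nat) : recursive_map G.
Proof. by case. Qed.

Lemma recursive_map_id n : recursive_map (fun x : n.-tuple nat => x).
Proof. exact: total_recursive_proj. Qed.

Lemma recursive_map_behead n :
  recursive_map (fun x : n.+1.-tuple nat => behead_tuple x).
Proof.
move=> i; apply: total_recursive_ext (total_recursive_proj (lift ord0 i)) => x.
by rewrite !(tnth_nth 0) /= nth_behead.
Qed.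

Lemma recursive_map_comp m n p (G : m.-tuple nat -> p.-tuple nat)
    (H : n.-tuple nat -> m.-tuple nat) :
  recursive_map G -> recursive_map H -> recursive_map (fun x => G (H x)).
Proof. by move=> rG rH i; exact: total_recursive_comp (rG i) rH. Qed.

Lemma total_recursive_comp1 n (f : nat -> nat) (g : n.-tuple nat -> nat) :
  total_recursive1 f -> total_recursive g -> total_recursive (fun x => f (g x)).
Proof.
move=> rf rg.
exact: total_recursive_comp rf
  (recursive_map_cons rg (recursive_map_nil (fun=> [tuple]))).
Qed.

Lemma total_recursive_succ n (f : n.-tuple nat -> nat) :
  total_recursive f -> total_recursive (fun x => (f x).+1).
Proof. by apply: total_recursive_comp1; exists Succ. Qed.

Lemma total_recursive_const n k : total_recursive (fun _ : n.-tuple nat => k).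
Proof.
elim: k => [|k]; first by exists (Zero n).
exact: total_recursive_succ.
Qed.

(** * Primitive recursion and arithmetic *)

Lemma total_recursive_nat_rec n (F : n.-tuple nat -> nat)
    (G : nat -> nat -> n.-tuple nat -> nat) (k : n.-tuple nat -> nat) :
  total_recursive F ->
  total_recursive (fun z : n.+2.-tuple nat =>
    G (thead z) (thead (behead_tuple z)) (behead_tuple (behead_tuple z))) ->
  total_recursive k ->
  total_recursive (fun x => nat_rec (fun=> nat) (F x) (fun i y => G i y x) (k x)).
Proof.
move=> [cF FE] [cG GE] rk.
have rP : total_recursive (fun z : n.+1.-tuple nat =>
    nat_rec (fun=> nat) (F (behead_tuple z))
      (fun i y => G i y (behead_tuple z)) (thead z)).
  exists (Prec cF cG) => z /=.
  elim: (thead z) => [|i IHi] /=; first exact: FE.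
  eexists; first exact: IHi.
  set y := nat_rec _ _ _ _.
  have := GE [tuple of i :: [tuple of y :: behead_tuple z]].
  rewrite !behead_tuple_cons !theadE.
  congr (eval _ _ _); exact: val_inj.
(* [rP] recurses on the head of its argument; putting [k x] there and keeping [x] as parameters
   allows any recursive bound. *)
have := total_recursive_comp rP (recursive_map_cons rk (@recursive_map_id n)).
by apply: total_recursive_ext => x; rewrite behead_tuple_cons theadE.
Qed.

Lemma total_recursive1_iter (f : nat -> nat) a :
  total_recursive1 f -> total_recursive1 (fun k => iter k f a).
Proof.
move=> rf.
apply: total_recursive_ext (total_recursive_nat_rec
  (G := fun _ y _ => f y) (total_recursive_const 1 a)
  (total_recursive_comp1 rf (@total_recursive_thead_behead _))
  (@total_recursive_thead 0)) => x.
by elim: (thead x) => //= k ->.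
Qed.

Lemma total_recursive_add n (f g : n.-tuple nat -> nat) :
  total_recursive f -> total_recursive g -> total_recursive (fun x => f x + g x).
Proof.
move=> rf rg.
apply: total_recursive_ext (total_recursive_nat_rec
  (G := fun _ y _ => y.+1) rf
  (total_recursive_succ (@total_recursive_thead_behead _)) rg) => x.
by elim: (g x) => [|k /= ->]; rewrite ?addn0 ?addnS.
Qed.

Lemma total_recursive_pred n (f : n.-tuple nat -> nat) :
  total_recursive f -> total_recursive (fun x => (f x).-1).
Proof.
move=> rf.
apply: total_recursive_ext (total_recursive_nat_rec
  (G := fun i _ _ => i) (total_recursive_const n 0)
  (@total_recursive_thead _) rf) => x.
by case: (f x).
Qed.

Lemma total_recursive_sub n (f g : n.-tuple nat -> nat) :
  total_recursive f -> total_recursive g -> total_recursive (fun x => f x - g x).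
Proof.
move=> rf rg.
apply: total_recursive_ext (total_recursive_nat_rec
  (G := fun _ y _ => y.-1) rf
  (total_recursive_pred (@total_recursive_thead_behead _)) rg) => x.
by elim: (g x) => [|k /= ->]; rewrite ?subn0 ?subnS.
Qed.

Lemma total_recursive_mul n (f g : n.-tuple nat -> nat) :
  total_recursive f -> total_recursive g -> total_recursive (fun x => f x * g x).
Proof.
move=> rf rg.
have rf' : total_recursive (fun z : n.+2.-tuple nat =>
    thead (behead_tuple z) + f (behead_tuple (behead_tuple z))).
  apply: total_recursive_add; first exact: total_recursive_thead_behead.
  apply: total_recursive_comp rf _.
  exact: recursive_map_comp (@recursive_map_behead _) (@recursive_map_behead _).
apply: total_recursive_ext (total_recursive_nat_rec
  (G := fun _ y x => y + f x) (total_recursive_const n 0) rf' rg) => x.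
by elim: (g x) => [|k /= ->]; rewrite ?muln0 ?mulnSr.
Qed.

(** * Recursive predicates, bounded quantification and minimization *)

Lemma recursive_predN n (b : n.-tuple nat -> bool) :
  recursive_pred b -> recursive_pred (fun x => ~~ b x).
Proof.
move=> /(total_recursive_sub (total_recursive_const n 1)).
by apply: total_recursive_ext => x; case: (b x).
Qed.

Lemma recursive_predI n (b c : n.-tuple nat -> bool) :
  recursive_pred b -> recursive_pred c -> recursive_pred (fun x => b x && c x).
Proof.
move=> rb rc; apply: total_recursive_ext (total_recursive_mul rb rc) => x.
by case: (b x) => //=; rewrite mul1n.
Qed.

Lemma recursive_pred_leq n (f g : n.-tuple nat -> nat) :
  total_recursive f -> total_recursive g -> recursive_pred (fun x => f x <= g x).
Proof.
move=> rf rg.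
apply: total_recursive_ext
  (total_recursive_sub (total_recursive_const n 1) (total_recursive_sub rf rg)).
move=> x; lia.
Qed.

Lemma recursive_pred_eq n (f g : n.-tuple nat -> nat) :
  total_recursive f -> total_recursive g -> recursive_pred (fun x => f x == g x).
Proof.
move=> rf rg.
apply: total_recursive_ext
  (recursive_predI (recursive_pred_leq rf rg) (recursive_pred_leq rg rf)) => x.
by rewrite eqn_leq.
Qed.

(** Equality of tuples is a finite conjunction over the coordinates, built by induction on a list of
    indices. *)
Lemma recursive_pred_eq_map n m (F G : n.-tuple nat -> m.-tuple nat) :
  recursive_map F -> recursive_map G -> recursive_pred (fun x => F x == G x).
Proof.
move=> rF rG.
have rE : forall s : seq 'I_m,
    recursive_pred (fun x => all (fun i => tnth (F x) i == tnth (G x) i) s).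
  elim=> [|i s IHs]; first exact: total_recursive_const.
  exact: recursive_predI (recursive_pred_eq (rF i) (rG i)) IHs.
apply: total_recursive_ext (rE (enum 'I_m)) => x; congr nat_of_bool.
apply/allP/eqP => [eqFG|-> //].
by apply: eq_from_tnth => i; apply/eqP/eqFG; rewrite mem_enum.
Qed.

Lemma total_recursive_if n (b : n.-tuple nat -> bool) (f g : n.-tuple nat -> nat) :
  recursive_pred b -> total_recursive f -> total_recursive g ->
  total_recursive (fun x => if b x then f x else g x).
Proof.
move=> rb rf rg.
apply: total_recursive_ext (total_recursive_add (total_recursive_mul rb rf)
  (total_recursive_mul (recursive_predN rb) rg)) => x.
by case: (b x); rewrite /= !(mul0n, mul1n, addn0).
Qed.

(** A bounded universal quantifier is the product of the truth values, computed by primitive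
    recursion on the bound. *)
Lemma recursive_pred_all_lt n (b : nat -> n.-tuple nat -> bool)
    (k : n.-tuple nat -> nat) :
  recursive_pred (fun z : n.+1.-tuple nat => b (thead z) (behead_tuple z)) ->
  total_recursive k ->
  recursive_pred (fun x => all (b^~ x) (iota 0 (k x))).
Proof.
move=> rb rk.
have rb' : total_recursive (fun z : n.+2.-tuple nat => thead (behead_tuple z) *
    nat_of_bool (b (thead z) (behead_tuple (behead_tuple z)))).
  apply: total_recursive_mul; first exact: total_recursive_thead_behead.
  have := total_recursive_comp rb (recursive_map_cons (@total_recursive_thead _)
    (recursive_map_comp (@recursive_map_behead _) (@recursive_map_behead _))).
  by apply: total_recursive_ext => z; rewrite theadE behead_tuple_cons.
apply: total_recursive_ext (total_recursive_nat_rec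
  (G := fun i y x => y * nat_of_bool (b i x)) (total_recursive_const n 1) rb' rk).
move=> x; elim: (k x) => // i IHi.
by rewrite -[X in iota 0 X]addn1 iotaD all_cat /= IHi andbT add0n mulnb.
Qed.

Lemma total_recursive_min n (b : nat -> n.-tuple nat -> bool) :
  recursive_pred (fun z : n.+1.-tuple nat => b (thead z) (behead_tuple z)) ->
  (forall x, exists k, b k x) ->
  exists2 h : n.-tuple nat -> nat, total_recursive h &
    forall x, b (h x) x /\ forall j, b j x -> h x <= j.
Proof.
move=> /recursive_predN[c cE] bP.
exists (fun x => ex_minn (bP x)); last by move=> x; case: ex_minnP.
(* [c] computes the negation of [b], so its first zero is the least [k] satisfying [b]; at smaller
   arguments its value is [1], the successor of the witness [0]. *)
exists (Mu c) => x /=; case: ex_minnP => k bk kmin; split.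
  by have := cE [tuple of k :: x]; rewrite theadE behead_tuple_cons bk.
move=> j jk; exists 0; have := cE [tuple of j :: x].
rewrite theadE behead_tuple_cons; case: (boolP (b j x)) => // /kmin.
by rewrite leqNgt jk.
Qed.

(** Shifting the argument by one lowers the bound [B], and one case distinction on zero recovers
    [f]. Nothing is asked about how [f] is defined, so it may come from a classical choice. *)
Lemma total_recursive1_of_finite_support (f : nat -> nat) B :
  (forall x, B <= x -> f x = 0) -> total_recursive1 f.
Proof.
elim: B f => [|B IHB] f f0.
  by apply: total_recursive_ext (total_recursive_const 1 0) => x; rewrite f0.
have rS : total_recursive1 (fun x => f x.+1) by apply: IHB => x xB; exact: f0.
apply: total_recursive_ext (total_recursive_nat_rec
  (G := fun i _ _ => f i.+1) (total_recursive_const 1 (f 0))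
  (total_recursive_comp1 rS (@total_recursive_thead _))
  (@total_recursive_thead 0)) => x.
by case: (thead x).
Qed.

(** * Decoding pairs and tuples from numbers *)

(* The pair [(a, b)] is coded by [(a + b) ^ 2 + a], whose integer square root
   is [a + b]. *)
Lemma exists_unpairing : exists p q : nat -> nat,
  [/\ total_recursive1 p, total_recursive1 q &
      forall a b, exists n, p n = a /\ q n = b].
Proof.
(* The least such [s] is the integer square root of the argument. *)
pose b s (x : 1.-tuple nat) := (thead x).+1 <= s.+1 * s.+1.
have [] := @total_recursive_min 1 b.
- apply: recursive_pred_leq.
    exact: total_recursive_succ (@total_recursive_thead_behead _).
  apply: total_recursive_mul;
    exact: total_recursive_succ (@total_recursive_thead _).
- by move=> x; exists (thead x); rewrite /b; nia.
move=> s rs sP.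
pose p (x : 1.-tuple nat) := thead x - s x * s x.
have rp : total_recursive p.
  by apply: total_recursive_sub (@total_recursive_thead _)
    (total_recursive_mul rs rs).
exists (fun n => p [tuple n]), (fun n => s [tuple n] - p [tuple n]); split.
- by apply: total_recursive_ext rp => x; rewrite tuple1_thead.
- by apply: total_recursive_ext (total_recursive_sub rs rp) => x; rewrite tuple1_thead.
move=> c d; exists ((c + d) * (c + d) + c).
set x := [tuple _].
have [sx smin] := sP x.
(* This holds because [(c + d) ^ 2 <= (c + d) ^ 2 + c < (c + d + 1) ^ 2]. *)
have sE : s x = c + d.
  have : s x <= c + d by apply: smin; rewrite /b /x theadE; nia.
  by move: sx; rewrite /b /x theadE; nia.
by rewrite /p sE /x theadE; lia.
Qed.

(** A number is read as a nested pair: [q] drops an entry and [p] reads one, so coordinate [i] is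
    [p (iter i q k)]. *)
Lemma exists_untupling r : exists U : nat -> r.-tuple nat,
  (forall i, total_recursive1 (fun k => tnth (U k) i)) /\
  forall x, exists k, U k = x.
Proof.
have [p [q [rp rq pqP]]] := exists_unpairing.
exists (fun k => [tuple p (iter i q k) | i < r]); split=> [i|x].
  apply: (@total_recursive_ext _ (fun x => p (iter i q (thead x)))) => [x|].
    by rewrite tnth_mktuple.
  apply: total_recursive_comp1 rp _.
  elim: (nat_of_ord i) => [|j IHj] /=; first exact: total_recursive_thead.
  exact: total_recursive_comp1 rq IHj.
have codeP (s : seq nat) :
    exists k, forall i, i < size s -> p (iter i q k) = nth 0 s i.
  elim: s => [|a s [k IHs]]; first by exists 0.
  have [k' [pk qk]] := pqP a k; exists k' => -[|i] //= ilt.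
  by rewrite -iterS iterSr qk IHs.
have [k kP] := codeP x; exists k; apply: eq_from_tnth => i.
by rewrite tnth_mktuple kP ?size_tuple // (tnth_nth 0).
Qed.

(** * Closure properties of listable sets *)

Lemma listable_image n m (G : n.-tuple nat -> m.-tuple nat) (S : set (n.-tuple nat)) :
  recursive_map G -> listable S -> listable (G @` S).
Proof.
move=> rG [->|[f rf ->]]; first by left; rewrite image_set0.
right; exists (G \o f); last by rewrite image_comp.
by move=> i; exact: total_recursive_comp (rG i) rf.
Qed.

(** If [S] has an element [a], run through all tuples and output [a] in place of each tuple outside
    [S]. *)
Lemma decidable_listable n (S : set (n.-tuple nat)) :
  decidable_set S -> listable S.
Proof.
move=> dS; have [[a Sa]|S0] := pselect (exists a, S a); last first.
  by left; apply/seteqP; split=> // x Sx; case: S0; exists x.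
have [U [rU surjU]] := exists_untupling n.
right; exists (fun k => if `[< S (U k) >] then U k else a) => [i|].
  apply: (@total_recursive_ext _ (fun x : 1.-tuple nat =>
    if `[< S (U (thead x)) >] then tnth (U (thead x)) i else tnth a i)).
    by move=> x; case: ifP.
  apply: total_recursive_if (rU i) (total_recursive_const 1 _).
  exact: (total_recursive_comp dS (G := fun x => U (thead x)) rU).
apply/seteqP; split=> [x Sx|_ [k _ <-]]; last by case: asboolP.
by have [k Uk] := surjU x; exists k; rewrite ?Uk ?asboolT.
Qed.

(** With [f] enumerating [S], the pairs [(k, x)] with [f k = G x] form a decidable set, and the
    preimage is its projection along [k]. *)
Lemma listable_preimage n m (G : n.-tuple nat -> m.-tuple nat)
    (S : set (m.-tuple nat)) :
  recursive_map G -> listable S -> listable (G @^-1` S).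
Proof.
move=> rG [->|[f rf ->]]; first by left; rewrite preimage_set0.
pose D := [set z : n.+1.-tuple nat | f (thead z) = G (behead_tuple z)].
have dD : decidable_set D.
  apply: total_recursive_ext (recursive_pred_eq_map
    (F := fun z : n.+1.-tuple nat => f (thead z))
    (G := fun z => G (behead_tuple z)) _ _) => [z|i|].
  - by congr nat_of_bool; apply/eqP/asboolP.
  - exact: total_recursive_comp1 (rf i) (@total_recursive_thead _).
  - exact: recursive_map_comp rG (@recursive_map_behead _).
have -> : G @^-1` range f = (fun z => behead_tuple z) @` D.
  apply/seteqP; split => [x [k _ fk]|_ [z Dz <-]]; last by exists (thead z).
  exists [tuple of k :: x]; last exact: behead_tuple_cons.
  by rewrite /D /= theadE behead_tuple_cons.
exact: listable_image (@recursive_map_behead _) (decidable_listable dD).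
Qed.

(** Search an enumeration of [S] for the first pair whose first coordinate is [m], and return its
    second coordinate. *)
Lemma listable_uniformization (S : nat -> nat -> Prop) :
  listable [set x : 2.-tuple nat | S (tnth x ord0) (tnth x ord_max)] ->
  (forall m, exists n, S m n) ->
  exists2 h, total_recursive1 h & forall m, S m (h m).
Proof.
have S2 m n : S m n -> [set x : 2.-tuple nat |
  S (tnth x ord0) (tnth x ord_max)] [tuple m; n] by [].
move=> [S0|[f rf fS]] totS.
  by have [n /S2] := totS 0; rewrite S0.
pose b t (x : 1.-tuple nat) := tnth (f t) ord0 == thead x.
have [] := @total_recursive_min 1 b.
- apply: recursive_pred_eq (@total_recursive_thead_behead _).
  exact: total_recursive_comp1 (rf ord0) (@total_recursive_thead _).
- move=> x; have [n /S2] := totS (thead x); rewrite fS => -[t _ ft].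
  by exists t; rewrite /b ft.
move=> t rt tP; exists (fun m => tnth (f (t [tuple m])) ord_max).
  apply: total_recursive_ext (total_recursive_comp1 (rf ord_max) rt) => x.
  by rewrite tuple1_thead.
move=> m; have [/eqP ft _] := tP [tuple m].
have : range f (f (t [tuple m])) by exists (t [tuple m]).
by rewrite -fS /= ft.
Qed.

(** * The equality kernel of a presentation *)

Lemma recursive_pred_eq_kernel T (rho : nat -> T) n (f g : n.-tuple nat -> nat) :
  decidable_set (eq_kernel rho) -> total_recursive f -> total_recursive g ->
  recursive_pred (fun x => `[< rho (f x) = rho (g x) >]).
Proof.
move=> dE rf rg.
exact: total_recursive_comp dE (recursive_map_cons rf
  (recursive_map_cons rg (recursive_map_nil (fun=> [tuple])))).
Qed.

Lemma listable_eq_kernel T (rho : nat -> T) n (f g : n.-tuple nat -> nat) :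
  listable (eq_kernel rho) -> total_recursive f -> total_recursive g ->
  listable [set x | rho (f x) = rho (g x)].
Proof.
move=> lE rf rg.
exact: listable_preimage (recursive_map_cons rf
  (recursive_map_cons rg (recursive_map_nil (fun=> [tuple])))) lE.
Qed.

(** The kernel is the pullback of the equality symbol, which every language contains. *)
Lemma listable_eq_kernel_presentation (L : language) (M : structure L)
    (rho : nat -> M) :
  listable_presentation rho -> listable (eq_kernel rho).
Proof.
move=> [_ /(_ EqSym)]; congr listable.
by apply/seteqP; split=> x /=; rewrite /pullback /= !tnth_map.
Qed.

(** * A recursive walk along first occurrences *)

(* The first occurrences in the sequence [rho] are listed in increasing order;
   if there are finitely many of them, the listing restarts from [0] after the
   last one. *)
Lemma exists_deterministic_walk T (rho : nat -> T) :
  decidable_set (eq_kernel rho) ->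
  exists h : nat -> nat,
    [/\ total_recursive1 h, forall j, exists k, rho (h k) = rho j &
        forall k l, rho (h k) = rho (h l) -> rho (h k.+1) = rho (h l.+1)].
Proof.
move=> dE.
(* [new j] says that [j] is the first index at which the value [rho j] occurs. *)
pose new j := all (fun i => ~~ `[< rho i = rho j >]) (iota 0 j).
have newP j : reflect (forall i, i < j -> rho i <> rho j) (new j).
  apply: (iffP allP) => [nj i ij|nj i].
    by apply/asboolPn/nj; rewrite mem_iota.
  by rewrite mem_iota => /andP[_ /nj] /asboolPn.
have rnew n (f : n.-tuple nat -> nat) :
    total_recursive f -> recursive_pred (fun x => new (f x)).
  have rn : total_recursive1 (fun j => nat_of_bool (new j)).
    apply: (recursive_pred_all_lt (b := fun i (x : 1.-tuple nat) =>
      ~~ `[< rho i = rho (thead x) >])) (@total_recursive_thead _).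
    apply: recursive_predN; apply: recursive_pred_eq_kernel dE _ _.
      exact: total_recursive_thead.
    exact: total_recursive_thead_behead.
  exact: total_recursive_comp1 rn.
have [nu [rnu nu_new nu_next]] : exists nu : nat -> nat,
    [/\ total_recursive1 nu, forall x, new (nu x) &
        forall x j, x < j -> new j -> x < nu x <= j].
  (* A classical split: with infinitely many first occurrences, [nu] is an unbounded search;
     otherwise it vanishes from [B] on and is recursive by finite support. *)
  have [next|/existsNP[B noB]] :=
      pselect (forall x, exists j, (x < j) && new j).
    have [|x|nu rnu nuP] := @total_recursive_min 1
        (fun j x => (thead x < j) && new j).
    - apply: recursive_predI; last exact: rnew (@total_recursive_thead _).
      apply: recursive_pred_leq (@total_recursive_thead _).
      exact: total_recursive_succ (@total_recursive_thead_behead _).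
    - exact: next.
    exists (fun x => nu [tuple x]); split.
    + by apply: total_recursive_ext rnu => x; rewrite tuple1_thead.
    + by move=> x; have [/andP[]] := nuP [tuple x].
    + move=> x j xj nj; have [/andP[xnu _] ->] := nuP [tuple x].
        by rewrite xnu.
      by rewrite theadE xj.
  have lastB x j : B <= x -> ~~ ((x < j) && new j).
    move=> Bx; apply/negP => /andP[xj nj]; apply: noB; exists j.
    by rewrite nj (leq_ltn_trans Bx).
  (* The default [0] is itself a first occurrence, vacuously, so the restart stays among first
     occurrences. *)
  pose nu x := if pselect (exists j, (x < j) && new j) is left ex
               then ex_minn ex else 0.
  exists nu; split.
  - apply: (@total_recursive1_of_finite_support _ B) => x Bx.
    rewrite /nu; case: pselect => // ex; case: ex_minnP => j.
    by rewrite (negbTE (lastB _ _ Bx)).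
  - move=> x; rewrite /nu; case: pselect => // ex.
    by case: ex_minnP => j /andP[].
  - move=> x j xj nj; rewrite /nu; case: pselect => [ex|[]]; last first.
      by exists j; rewrite xj.
    by case: ex_minnP => i /andP[-> _] /(_ j) ->; rewrite ?xj.
pose h k := iter k nu 0.
have h_new k : new (h k) by case: k => // k; exact: nu_new.
(* Since every [h k] is new, this says that the greatest first occurrence up to [j] is visited by
   the walk. *)
have h_reach j : exists2 k, h k <= j & forall i, new i -> i <= j -> i <= h k.
  elim: j => [|j [k hk kmax]]; first by exists 0.
  have [nj|nj] := boolP (new j.+1); last first.
    exists k => [|i ni]; first exact: leqW.
    rewrite leq_eqVlt => /orP[/eqP ij|]; last exact: kmax.
    by rewrite -ij ni in nj.
  (* The next step lands in the interval from [h k + 1] to [j.+1]; by maximality of [h k] up to [j],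
     it lands on [j.+1] exactly. *)
  have /andP[lt_nu nu_le] := nu_next _ _ (hk : h k < j.+1) nj.
  exists k.+1 => // i ni ij; apply: leq_trans ij _.
  by rewrite ltnNge; apply/negP => /(kmax _ (h_new k.+1)); rewrite leqNgt lt_nu.
exists h; split=> [|j|k l hkl].
- exact: total_recursive1_iter.
(* The least index [i] with the value [rho j] is a first occurrence, and [h_reach] at [i] shows that
   it is visited. *)
- have [i /asboolP ij imin] := ex_minnP
    (ex_intro (fun i => `[< rho i = rho j >]) j (asboolT erefl)).
  have ni : new i.
    apply/newP => i' i'i eq_i'; have := imin i'.
    by rewrite eq_i' ij asboolT // leqNgt i'i => /(_ isT).
  have [k hk kmax] := h_reach i; exists k; rewrite -ij; congr rho.
  by apply/eqP; rewrite eqn_leq hk kmax.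
(* Two first occurrences of the same value coincide, and [h k.+1] is [nu (h k)]. *)
- suff hE : h k = h l by congr (rho (nu _)).
  by case: (ltngtP (h k) (h l)) => // [/(newP _ (h_new l))|/(newP _ (h_new k))];
    rewrite hkl.
Qed.

(** * Comparison of two presentations *)

(** As [gamma = rho \o phi] is surjective, each [n] has some [m] with [rho n = rho (phi m)]; this
    relation is listable, so uniformization selects [m] recursively. *)
Lemma equivalent_presentations_sym (L : language) (M : structure L)
    (rho gamma : nat -> M) :
  listable_presentation rho -> listable_presentation gamma ->
  equivalent_presentations rho gamma -> equivalent_presentations gamma rho.
Proof.
move=> hrho [surj_gamma _] [phi rphi gammaE].
have [|n|psi rpsi psiP] := @listable_uniformization
    (fun n m => rho n = rho (phi m)).
- apply: listable_eq_kernel; first exact: listable_eq_kernel_presentation.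
    exact: total_recursive_proj.
  exact: total_recursive_comp1 rphi (total_recursive_proj _).
- by have [m <-] := surj_gamma (rho n); exists m; rewrite gammaE.
by exists psi => //; apply/funext => n; rewrite psiP gammaE.
Qed.

(** The pullback along [rho \o phi] is the preimage, under [phi] applied coordinatewise, of the
    pullback along [rho]. *)
Lemma equivalent_presentations_listable_sets T (rho gamma : nat -> T) r :
  equivalent_presentations rho gamma ->
  listable_sets rho r `<=` listable_sets gamma r.
Proof.
move=> [phi rphi ->] X.
have rphi_map : recursive_map (@map_tuple r nat nat phi).
  move=> i; apply: total_recursive_ext
    (total_recursive_comp1 rphi (total_recursive_proj i)) => x.
  by rewrite tnth_map.
move=> /(listable_preimage rphi_map); congr listable.
apply/seteqP; split=> x; rewrite /pullback /preimage /=;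
  by congr X; apply: eq_from_tnth => i; rewrite !tnth_map.
Qed.

Lemma listable_sets_equivalent_presentations (L : language) (M : structure L)
    (rho gamma : nat -> M) :
  listable_presentation rho -> listable_presentation gamma ->
  decidable_set (eq_kernel rho) ->
  (forall r, listable_sets rho r `<=` listable_sets gamma r) ->
  equivalent_presentations rho gamma.
Proof.
move=> hrho hgamma dE sub.
have lE := decidable_listable dE.
have lEg := listable_eq_kernel_presentation hgamma.
have [surj_rho _] := hrho; have [surj_gamma _] := hgamma.
have [h [rh h_surj h_det]] := exists_deterministic_walk dE.
(* By [h_det], [S] is the graph of a function on [M], although the walk may visit a point many
   times. *)
pose S : set (2.-tuple M) := [set z | exists k,
  tnth z ord0 = rho (h k) /\ tnth z ord_max = rho (h k.+1)].
have lS : listable (pullback gamma S).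
  apply: sub.
  (* Keeping the witness [k] as first coordinate makes the condition decidable; forgetting it gives
     the [rho]-pullback of [S]. *)
  pose D := [set z : 3.-tuple nat |
    rho (thead (behead_tuple z)) = rho (h (thead z)) /\
    rho (tnth z ord_max) = rho (h (thead z).+1)].
  have dD : decidable_set D.
    have rk := @total_recursive_thead 2.
    apply: total_recursive_ext (recursive_predI
      (recursive_pred_eq_kernel dE (@total_recursive_thead_behead 1)
        (total_recursive_comp1 rh rk))
      (recursive_pred_eq_kernel dE (total_recursive_proj ord_max)
        (total_recursive_comp1 rh (total_recursive_succ rk)))) => z.
    by rewrite /= -asbool_and.
  move: (listable_image (@recursive_map_behead 2) (decidable_listable dD)).
  congr listable; apply/seteqP; split=> [_ [z [Dz Dz1] <-]|x [k]].
    exists (thead z); rewrite !tnth_map -Dz -Dz1.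
    by split; congr rho; rewrite !(tnth_nth 0) /= nth_behead.
  rewrite !tnth_map => -[xk xk1]; exists [tuple of k :: x].
    rewrite /D /= behead_tuple_cons theadE -xk -xk1.
    by split; congr rho; rewrite !(tnth_nth 0).
  exact: behead_tuple_cons.
(* [sigma] performs one step of the walk on [gamma]-indices; it is total because the walk meets
   every point of [M]. *)
have [||sigma rsigma sigmaP] := @listable_uniformization
    (fun m n => S [tuple gamma m; gamma n]).
- move: lS; congr listable; apply/seteqP; split=> x [k xk];
    by exists k; move: xk; rewrite !tnth_map.
- move=> m; have [j jm] := surj_rho (gamma m); have [k kj] := h_surj j.
  have [n nk] := surj_gamma (rho (h k.+1)).
  by exists n; exists k; rewrite /= kj jm.
have [m0 m0E] := surj_gamma (rho (h 0)).
pose u k := iter k sigma m0.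
have uE k : gamma (u k) = rho (h k).
  (* The pair found by [sigma] may come from a position [l] other than [k], but
     [rho (h l) = rho (h k)], so [h_det] identifies the successors. *)
  elim: k => //= k IHk; have [l [el er]] := sigmaP (u k).
  by apply: etrans er (h_det _ _ _); rewrite -IHk; exact: esym el.
(* This search uses only that the kernel of [gamma] is listable. *)
have [||psi rpsi psiP] := @listable_uniformization
    (fun m k => gamma m = gamma (u k)).
- apply: listable_eq_kernel lEg (total_recursive_proj _) _.
  exact: total_recursive_comp1 (total_recursive1_iter _ rsigma)
    (total_recursive_proj _).
- move=> m; have [j jm] := surj_rho (gamma m); have [k kj] := h_surj j.
  by exists k; rewrite uE kj.
exists (fun m => h (psi m)); first exact: total_recursive_comp1 rh rpsi.
by apply/funext => m; rewrite psiP uE.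
Qed.

Theorem theorem3p21 (L : language) (M : structure L) (rho gamma : nat -> M)
    (hM : listable_structure M)
    (hrho : listable_presentation rho) (hgamma : listable_presentation gamma) :
  (equivalent_presentations rho gamma ->
     forall r : nat, listable_sets rho r = listable_sets gamma r) /\
  ((forall r : nat, listable_sets rho r = listable_sets gamma r) ->
     forall r : nat, listable_sets rho r `<=` listable_sets gamma r) /\
  (decidable_set (eq_kernel rho) ->
     (equivalent_presentations rho gamma <->
        forall r : nat, listable_sets rho r = listable_sets gamma r) /\
     ((forall r : nat, listable_sets rho r = listable_sets gamma r) <->
        forall r : nat, listable_sets rho r `<=` listable_sets gamma r)).
Proof.
have i_ii : equivalent_presentations rho gamma ->
    forall r : nat, listable_sets rho r = listable_sets gamma r.
  (* The first inclusion is direct; the reverse one uses symmetry of equivalence. *)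
  move=> eq_rg r; apply/seteqP; split.
    exact: equivalent_presentations_listable_sets.
  exact/equivalent_presentations_listable_sets/equivalent_presentations_sym.
have ii_iii : (forall r : nat, listable_sets rho r = listable_sets gamma r) ->
    forall r : nat, listable_sets rho r `<=` listable_sets gamma r.
  by move=> eq_sets r; rewrite eq_sets.
split=> //; split=> // dE.
have iii_i := listable_sets_equivalent_presentations hrho hgamma dE.
split; split=> //; first by move=> /ii_iii/iii_i.
by move=> /iii_i/i_ii.
Qed.
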